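(* Let $\mu$ be any quasi-definite linear functional with monic orthogonal polynomials $(P_n)_{n\ge0}$, and let $\widetilde\mu$ be any linear functional satisfying $\Psi\widetilde\mu=\Phi\mu$ for polynomials $\Phi(x)=\prod_{k=1}^N(x-z_k)$ and $\Psi(x)=\prod_{k=1}^M(x-w_k)$ with simple zeros. Choose any linear functional $\check\mu$ with $\Phi\check\mu=\widetilde\mu$, and let $$Q_n(w_k)=\check\mu\left[P_n(x)\frac{\Psi(x)}{x-w_k}\right],\qquad k=1,\dots,M.$$ Then $n\ge M$ is normal for $\widetilde\mu$ if and only if $D_n\ne0$, where $$D_n=\det\begin{pmatrix} P_{n+N-1}(z_1)&\cdots&P_{n-M}(z_1)\\ \vdots&\ddots&\vdots\\ P_{n+N-1}(z_N)&\cdots&P_{n-M}(z_N)\\ Q_{n+N-1}(w_1)&\cdots&Q_{n-M}(w_1)\\ \vdots&\ddots&\vdots\\ Q_{n+N-1}(w_M)&\cdots&Q_{n-M}(w_M) \end{pmatrix},$$ and then the monic orthogonal polynomial $\widetilde P_n$ of degree $n$ with respect to $\widetilde\mu$ is given by $$\widetilde P_n(x)=\Phi(x)^{-1}D_n^{-1}\det\begin{pmatrix} P_{n+N}(x)&P_{n+N-1}(x)&\cdots&P_{n-M}(x)\\ P_{n+N}(z_1)&P_{n+N-1}(z_1)&\cdots&P_{n-M}(z_1)\\ \vdots&\vdots&\ddots&\vdots\\ P_{n+N}(z_N)&P_{n+N-1}(z_N)&\cdots&P_{n-M}(z_N)\\ Q_{n+N}(w_1)&Q_{n+N-1}(w_1)&\cdots&Q_{n-M}(w_1)\\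 \vdots&\vdots&\ddots&\vdots\\ Q_{n+N}(w_M)&Q_{n+N-1}(w_M)&\cdots&Q_{n-M}(w_M) \end{pmatrix}.$$
   Context: A linear functional means a complex linear functional on the space $\mathbb{C}[x]$ of polynomials. For a polynomial $\Phi$ and a functional $\mu$, $\Phi\mu$ is the functional $(\Phi\mu)[P]=\mu[\Phi P]$. For a functional $\mu$ and $n\in\mathbb{N}=\{0,1,2,\dots\}$ consider the conditions $\mu[P_n(x)x^p]=0$ for $p=0,\dots,n-1$ and $\deg P_n\le n$. The index $n$ is normal for $\mu$ if every non-zero solution $P_n$ has degree exactly $n$ (equivalently, there is a unique monic solution of degree $n$; this is the monic orthogonal polynomial of degree $n$). The functional $\mu$ is quasi-definite if every $n\in\mathbb{N}$ is normal for $\mu$. The functionals $\widetilde\mu$ and $\check\mu$ are not assumed to be quasi-definite. *)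

(* Defs.v *)
From HB Require Import structures.
From mathcomp Require Import all_boot all_order all_algebra.
From mathcomp Require Export reals complex.

Set Implicit Arguments.
Unset Strict Implicit.
Unset Printing Implicit Defensive.

Import GRing.Theory.
Local Open Scope ring_scope.

Section Functionals.
Variable K : fieldType.
Implicit Types (mu : {scalar {poly K}}) (Phi Psi S : {poly K}) (n : nat).

Definition polymul Phi mu : {poly K} -> K := fun S => mu (Phi * S).

Fact polymul_is_scalar Phi mu : scalar (polymul Phi mu).
Proof. by move=> a S T; rewrite /polymul mulrDr -scalerAr linearP. Qed.
HB.instance Definition _ Phi mu :=
  GRing.isLinear.Build K {poly K} K *%R (polymul Phi mu)
    (polymul_is_scalar Phi mu).

(* [size S] is the degree of S plus one for S != 0, and 0 for S = 0, so that
   [size S <= n.+1] says deg S <= n and [size S = n.+1] says deg S = n. *)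
Definition orthogonal_solution mu n S : Prop :=
  (size S <= n.+1)%N /\ forall p : nat, (p < n)%N -> mu (S * 'X^p) = 0.

Definition normal_index mu n : Prop :=
  forall S, S != 0 -> orthogonal_solution mu n S -> size S = n.+1.

Definition quasi_definite mu : Prop := forall n, normal_index mu n.

Definition monic_orthogonal mu n S : Prop :=
  [/\ S \is monic, size S = n.+1 & orthogonal_solution mu n S].

(* The division by x - w_k is exact when Psi is the product of the x - w_k. *)
Definition Qval mu Psi (Pn : {poly K}) (wk : K) : K :=
  mu (Pn * (Psi %/ ('X - wk%:P))).

(* Rows P_l(z_1), ..., P_l(z_N), Q_l(w_1), ..., Q_l(w_M), with the index l
   decreasing along the m columns: l = s, s - 1, ..., s - m + 1. *)
Definition PQ_mx (N M : nat) (z : 'I_N -> K) (w : 'I_M -> K)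
    (P : nat -> {poly K}) (muc : {scalar {poly K}}) Psi (s m : nat) :
    'M[K]_(N + M, m) :=
  col_mx (\matrix_(k < N, j < m) (P (s - j)%N).[z k])
         (\matrix_(k < M, j < m) Qval muc Psi (P (s - j)%N) (w k)).

(* For N = M = 0 the matrix is empty; otherwise n + N >= 1 as soon as
   n >= M, and no subtraction truncates. *)
Definition Dn (N M : nat) (z : 'I_N -> K) (w : 'I_M -> K)
    (P : nat -> {poly K}) (muc : {scalar {poly K}}) Psi n : K :=
  \det (PQ_mx z w P muc Psi (n + N).-1 (N + M)).

Definition numerator (N M : nat) (z : 'I_N -> K) (w : 'I_M -> K)
    (P : nat -> {poly K}) (muc : {scalar {poly K}}) Psi n : {poly K} :=
  \det (col_mx (\row_(j < 1 + (N + M)) P (n + N - j)%N)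
               (map_mx polyC (PQ_mx z w P muc Psi (n + N) (1 + (N + M))))).

End Functionals.

(* Main.v *)
Require Import Defs.
From mathcomp Require Import zify.
From mathcomp Require Import all_boot all_order all_algebra.

Import GRing.Theory.
Local Open Scope ring_scope.
Local Open Scope complex_scope.

(** A polynomial S of degree at most n solves the orthogonality conditions for
    mut if and only if F = Phi S is a combination of P_(n+N), ..., P_(n-M) that
    vanishes at the z_k and satisfies muc[F Psi/(x - w_k)] = 0 for every k: the
    polynomials Psi x^q and Psi/(x - w_k) together span all test polynomials.
    Hence the solutions correspond to the kernel of the matrix with rows
    P_l(z_k) and Q_l(w_k), n+N >= l >= n-M.  The coefficient of x^n in S is the
    first coordinate of the kernel vector, and D_n is the minor without the
    first column, so normality means D_n != 0; the signed maximal minors give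
    a kernel vector, whose combination of the P_l is the numerator. *)

(** * Combinations of orthogonal polynomials with consecutive indices *)

Lemma size_ortho_comb (K : fieldType) (P : nat -> {poly K})
    (hP : forall l, size (P l) = l.+1) (s m : nat) (c : nat -> K) :
  (size (\sum_(j < m) c j *: P (s - j)%N)%R <= s.+1)%N.
Proof.
apply: (leq_trans (size_sum _ _ _)); apply/bigmax_leqP => j _.
by apply: (leq_trans (size_scale_leq _ _)); rewrite hP ltnS leq_subr.
Qed.

Lemma ortho_comb_recl (K : fieldType) (P : nat -> {poly K}) (s m : nat)
    (c : nat -> K) :
  \sum_(j < m.+1) c j *: P (s - j)%N =
    c 0%N *: P s + \sum_(j < m) c j.+1 *: P (s.-1 - j)%N.
Proof.
rewrite big_ord_recl subn0; congr (_ + _); apply: eq_bigr => j _.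
by rewrite /= /bump add1n -subn1 -subnDA add1n.
Qed.

Lemma coef_ortho_comb (K : fieldType) (P : nat -> {poly K})
    (hmonic : forall l, P l \is monic) (hP : forall l, size (P l) = l.+1)
    (s m : nat) (c : nat -> K) :
  (m <= s)%N -> (\sum_(j < m.+1) c j *: P (s - j)%N)`_s = c 0%N.
Proof.
move=> le_ms; rewrite ortho_comb_recl coefD coefZ.
have := monicP (hmonic s); rewrite lead_coefE hP /= => ->; rewrite mulr1.
(* If terms remain, the bound forces s > 0, so they have degree below s; at s = 0 the truncated
   index would repeat P_0. *)
case: m le_ms => [|m] le_ms; first by rewrite big_ord0 coef0 addr0.
rewrite [X in _ + X]nth_default ?addr0 //.
apply: (leq_trans (size_ortho_comb _ _ hP s.-1 m.+1 (fun j => c j.+1))); lia.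
Qed.

(** The bound on m prevents truncation, so the P_l have distinct degrees: the coefficient of x^s
    isolates [c 0], and induction handles the rest. *)
Lemma ortho_comb_free (K : fieldType) (P : nat -> {poly K})
    (hmonic : forall l, P l \is monic) (hP : forall l, size (P l) = l.+1)
    (m s : nat) (c : nat -> K) :
  (m <= s.+1)%N -> \sum_(j < m) c j *: P (s - j)%N = 0 ->
  forall j, (j < m)%N -> c j = 0.
Proof.
elim: m s c => [|m IHm] s c //= le_ms Fc0.
have c0: c 0%N = 0.
  by rewrite -(coef_ortho_comb _ _ hmonic hP s m) // Fc0 coef0.
move: Fc0; rewrite ortho_comb_recl c0 scale0r add0r => Fc0.
case=> [|j] //; rewrite ltnS => lt_jm.
by apply: (IHm s.-1 (fun j => c j.+1)) => //; lia.
Qed.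

(** Subtracting multiples of P_(a+m), ..., P_a in turn removes the top coefficients and keeps the
    orthogonality to x^q for q < a. What is left has degree below a, so normality of the index a
    makes it zero. *)
Lemma ortho_comb_exists (K : fieldType) (mu : {scalar {poly K}})
    (hmu : quasi_definite mu) (P : nat -> {poly K})
    (hP : forall l, monic_orthogonal mu l (P l)) (a m : nat) (F : {poly K}) :
  (size F <= (a + m).+1)%N ->
  (forall q, (q < a)%N -> mu (F * 'X^q) = 0) ->
  exists c : nat -> K, F = \sum_(j < m.+1) c j *: P (a + m - j)%N.
Proof.
elim: m F => [|m IHm] F sF oF.
  exists (fun=> F`_a); rewrite addn0 big_ord1 subn0.
  have [mP sP [_ oP]] := hP a.
  apply/eqP; rewrite -subr_eq0; apply/negPn/negP => G0.
  set G := F - _ in G0.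
  have sG : (size G <= a)%N.
    apply/leq_sizeP => j; rewrite leq_eqVlt => /predU1P[<-|lt_aj].
      have := monicP mP; rewrite lead_coefE sP /= => lP.
      by rewrite coefB coefZ lP mulr1 subrr.
    rewrite coefB coefZ [(P _)`_j]nth_default ?sP // mulr0 subr0 nth_default //.
    by apply: (leq_trans sF); rewrite addn0.
  have oG : orthogonal_solution mu a G.
    split=> [|q lt_qa]; first exact: leqW.
    by rewrite mulrBl raddfB /= -scalerAl linearZ /= oF // oP // mulr0 subr0.
  by rewrite (hmu _ _ G0 oG) ltnn in sG.
have [mP sP [_ oP]] := hP (a + m.+1)%N.
have [||c Fc] := IHm (F - F`_(a + m.+1) *: P (a + m.+1)%N).
- apply/leq_sizeP => j; rewrite -addnS leq_eqVlt => /predU1P[<-|lt_j].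
    have := monicP mP; rewrite lead_coefE sP /= => lP.
    by rewrite coefB coefZ lP mulr1 subrr.
  rewrite coefB coefZ [(P _)`_j]nth_default ?sP // mulr0 subr0 nth_default //.
  exact: (leq_trans sF).
- move=> q lt_qa; rewrite mulrBl raddfB /= -scalerAl linearZ /= oF //.
  by rewrite oP ?mulr0 ?subr0 //; lia.
pose c' j := if j is j'.+1 then c j' else F`_(a + m.+1).
exists c'; rewrite ortho_comb_recl /=; apply/eqP.
rewrite addrC -subr_eq Fc; apply/eqP.
by apply: eq_bigr => j _; rewrite addnS.
Qed.

Lemma monic_orthogonal_size_lt (K : fieldType) (mu : {scalar {poly K}})
    (l : nat) (S q : {poly K}) :
  orthogonal_solution mu l S -> (size q <= l)%N -> mu (S * q) = 0.
Proof.
move=> [_ oS] sq; rewrite -(coefK q) poly_def mulr_sumr raddf_sum /=.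
rewrite big1 // => i _; rewrite -scalerAr linearZ /= oS ?mulr0 //.
exact: leq_trans (ltn_ord i) sq.
Qed.

Lemma ortho_comb_mu0 (K : fieldType) (mu : {scalar {poly K}})
    (P : nat -> {poly K}) (hP : forall l, monic_orthogonal mu l (P l))
    (a m : nat) (c : nat -> K) (q : {poly K}) :
  (size q <= a)%N ->
  mu ((\sum_(j < m.+1) c j *: P (a + m - j)%N) * q) = 0.
Proof.
move=> sq; rewrite mulr_suml raddf_sum /= big1 // => j _.
rewrite -scalerAl linearZ /=.
have [_ _ oP] := hP (a + m - j)%N.
by rewrite (monic_orthogonal_size_lt _ _ _ _ _ oP) ?mulr0 //; have := ltn_ord j; lia.
Qed.

(** * Lagrange interpolation at the points w_k *)

Lemma prod_XsubC_divp (K : fieldType) (M : nat) (w : 'I_M -> K) (k : 'I_M) :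
  \prod_(j < M) ('X - (w j)%:P) %/ ('X - (w k)%:P) =
    \prod_(j < M | j != k) ('X - (w j)%:P).
Proof. by rewrite (bigD1 k) //= mulKp // polyXsubC_eq0. Qed.

Lemma size_prod_XsubC_ord (K : fieldType) (M : nat) (w : 'I_M -> K) :
  size (\prod_(j < M) ('X - (w j)%:P)) = M.+1.
Proof. by rewrite size_prod_XsubC /index_enum -enumT size_enum_ord. Qed.

(** With the interpolation weights, the difference of the two sides has degree below M and vanishes
    at M distinct points. *)
Lemma lagrange_expansion (K : fieldType) (M : nat) (w : 'I_M -> K)
    (hw : injective w) (r : {poly K}) :
  (size r <= M)%N ->
  exists b : 'I_M -> K,
    r = \sum_k b k *: (\prod_(j < M) ('X - (w j)%:P) %/ ('X - (w k)%:P)).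
Proof.
move=> sr; pose L k := \prod_(j < M | j != k) ('X - (w j)%:P).
have Lk k : (L k).[w k] != 0.
  rewrite horner_prod; apply/prodf_neq0 => j ne_jk.
  by rewrite hornerXsubC subr_eq0 (inj_eq hw) eq_sym.
have Lki k i : i != k -> (L k).[w i] = 0.
  by move=> ne_ik; rewrite horner_prod (bigD1 i) //= hornerXsubC subrr mul0r.
have sL k : (size (L k) <= M)%N.
  have := size_prod_XsubC_ord _ _ w; rewrite (bigD1 k) //= -/(L k).
  rewrite size_monicM ?monicXsubC ?size_XsubC //=; first by case=> /eq_leq.
  by apply/eqP => L0; have := Lk k; rewrite L0 horner0 eqxx.
exists (fun k => r.[w k] / (L k).[w k]).
under eq_bigr do rewrite prod_XsubC_divp -/(L _).
apply/eqP; rewrite -subr_eq0; apply/eqP.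
apply: (roots_geq_poly_eq0 (rs := [seq w i | i <- enum 'I_M])).
- apply/allP => _ /mapP[i _ ->]; rewrite rootE hornerD hornerN horner_sum.
  rewrite (bigD1 i) //= hornerZ divfK // big1 ?addr0 ?subrr // => k ne_ki.
  by rewrite hornerZ (Lki k i) ?mulr0 // eq_sym.
- by rewrite map_inj_uniq ?enum_uniq.
rewrite size_map size_enum_ord (leq_trans (size_polyD _ _)) // geq_max sr.
rewrite size_polyN (leq_trans (size_sum _ _ _)) //.
by apply/bigmax_leqP => k _; apply: (leq_trans (size_scale_leq _ _)).
Qed.

(** * The matrix with entries P_l(z_k) and Q_l(w_k) *)

Lemma PQ_mx_mulmx_eq0 (K : fieldType) (N M : nat) (z : 'I_N -> K)
    (w : 'I_M -> K) (P : nat -> {poly K}) (muc : {scalar {poly K}})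
    (Psi : {poly K}) (s m : nat) (c : nat -> K)
    (F := \sum_(j < m) c j *: P (s - j)%N) :
  PQ_mx z w P muc Psi s m *m (\col_j c j) = 0 <->
  (forall k, F.[z k] = 0) /\
  (forall k, muc (F * (Psi %/ ('X - (w k)%:P))) = 0).
Proof.
(* Each row lists the values of one linear functional at the P_l, so its product with the column of
   coefficients is that functional at F. *)
have Fz k : (PQ_mx z w P muc Psi s m *m (\col_j c j)) (lshift M k) 0 = F.[z k].
  rewrite mxE horner_sum; apply: eq_bigr => j _.
  by rewrite col_mxEu !mxE hornerZ mulrC.
have Fw k : (PQ_mx z w P muc Psi s m *m (\col_j c j)) (rshift N k) 0 =
    muc (F * (Psi %/ ('X - (w k)%:P))).
  rewrite mxE mulr_suml raddf_sum; apply: eq_bigr => j _.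
  rewrite col_mxEd !mxE /Qval /= -scalerAl linearZ.
  by rewrite /= mulrC.
split=> [A0|[Fz0 Fw0]].
  by split=> k; rewrite -?Fz -?Fw A0 mxE.
apply/matrixP => i j; rewrite ord1 [RHS]mxE.
by case: (split_ordP i) => k ->; rewrite ?Fz ?Fw.
Qed.

(** Exhibits the matrix of D_n as that of the numerator without its first column; the index identity
    survives truncated subtraction. *)
Lemma PQ_mx_rsubmx (K : fieldType) (N M : nat) (z : 'I_N -> K)
    (w : 'I_M -> K) (P : nat -> {poly K}) (muc : {scalar {poly K}})
    (Psi : {poly K}) (s m : nat) :
  rsubmx (PQ_mx z w P muc Psi s (1 + m)) = PQ_mx z w P muc Psi s.-1 m.
Proof.
have idx (j : nat) : (s - (1 + j) = s.-1 - j)%N by lia.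
apply/matrixP => i j; rewrite mxE.
by case: (split_ordP i) => k ->; rewrite ?col_mxEu ?col_mxEd !mxE /= idx.
Qed.

(** * Signed maximal minors, the generalized cross product of the rows *)

Definition maxminor {R : comPzRingType} {m : nat} (A : 'M[R]_(m, 1 + m))
    (j : 'I_(1 + m)) : R := (-1) ^+ j * \det (col' j A).

Lemma det_col_mx_row (R : comPzRingType) (m : nat) (r : 'rV[R]_(1 + m))
    (A : 'M[R]_(m, 1 + m)) :
  \det (col_mx r A) = \sum_j r 0 j * maxminor A j.
Proof.
rewrite (expand_det_row _ (lshift m ord0)); apply: eq_bigr => j _.
rewrite col_mxEu /cofactor add0n; congr (_ * (_ * \det _)).
apply/matrixP => i k.
have lift0i : lift (lshift m ord0) i = rshift 1 i by apply: val_inj.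
by rewrite mxE mxE lift0i col_mxEd mxE.
Qed.

(** Entry i of the product is the expansion of a determinant in which row i of A occurs twice. *)
Lemma mulmx_maxminor (R : comPzRingType) (m : nat) (A : 'M[R]_(m, 1 + m)) :
  A *m (\col_j maxminor A j) = 0.
Proof.
apply/matrixP => i j; rewrite ord1 [RHS]mxE mxE.
under eq_bigr do rewrite mxE.
rewrite -[RHS](determinant_alternate (A := col_mx (row i A) A)
  (i1 := lshift m ord0) (i2 := rshift 1 i)) //.
  by rewrite det_col_mx_row; apply: eq_bigr => k _; rewrite mxE.
by move=> k; rewrite col_mxEu col_mxEd mxE.
Qed.

Lemma maxminor0 (R : comPzRingType) (m : nat) (A : 'M[R]_(m, 1 + m)) :
  maxminor A ord0 = \det (rsubmx A).
Proof.
rewrite /maxminor expr0 mul1r; congr (\det _).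
by apply/matrixP => i j; rewrite !mxE; congr (A _ _); apply: val_inj.
Qed.

(** * Solutions for the transformed functional as kernel vectors *)

Section Transform.

Variables (K : fieldType) (mu : {scalar {poly K}}).
Hypothesis hmu : quasi_definite mu.
Variable P : nat -> {poly K}.
Hypothesis hP : forall n : nat, monic_orthogonal mu n (P n).
Variables (N M : nat) (z : 'I_N -> K) (w : 'I_M -> K).
Hypotheses (hz : injective z) (hw : injective w).
Let Phi : {poly K} := \prod_(k < N) ('X - (z k)%:P).
Let Psi : {poly K} := \prod_(k < M) ('X - (w k)%:P).
Variables (mut muc : {scalar {poly K}}).
Hypotheses (hmut : polymul Psi mut =1 polymul Phi mu).
Hypotheses (hmuc : polymul Phi muc =1 mut).
Variable n : nat.
Hypothesis hn : (M <= n)%N.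

Let comb (c : nat -> K) : {poly K} :=
  \sum_(j < (N + M).+1) c j *: P (n + N - j)%N.
Let A := PQ_mx z w P muc Psi (n + N) (1 + (N + M)).

Let monicP_ l : P l \is monic. Proof. by have [] := hP l. Qed.
Let sizeP l : size (P l) = l.+1. Proof. by have [] := hP l. Qed.
Let monicPhi : Phi \is monic. Proof. exact: monic_prod_XsubC. Qed.
Let sizePhi : size Phi = N.+1.
Proof. exact: size_prod_XsubC_ord. Qed.
Let monicPsi : Psi \is monic. Proof. exact: monic_prod_XsubC. Qed.
Let sizePsi : size Psi = M.+1.
Proof. exact: size_prod_XsubC_ord. Qed.

Let idx : (n + N = (n - M) + (N + M))%N.
Proof. by lia. Qed.

Let size_PhiM (S : {poly K}) : S != 0 -> size (Phi * S) = (N + size S)%N.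
Proof. by move=> S0; rewrite size_monicM // sizePhi. Qed.

(** Since Phi is monic of degree N, the top coefficient of Phi S detects whether S has degree n. *)
Let coef_PhiM (S : {poly K}) :
  (size S <= n.+1)%N -> (Phi * S)`_(n + N) = S`_n.
Proof.
rewrite leq_eqVlt => /predU1P[sS|sS].
  have S0 : S != 0 by rewrite -size_poly_eq0 sS.
  have := lead_coefM Phi S; rewrite (monicP monicPhi) mul1r !lead_coefE.
  by rewrite size_PhiM // sS addnS addnC.
have [->|S0] := eqVneq S 0; first by rewrite mulr0 !coef0.
by rewrite !nth_default // size_PhiM // addnC leq_add2r.
Qed.

Lemma kernel_of_solution (S : {poly K}) :
  orthogonal_solution mut n S ->
  exists2 c : nat -> K, Phi * S = comb c & A *m (\col_j c j) = 0.
Proof.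
move=> solS; have [sS oS] := solS.
have [||c Fc] := @ortho_comb_exists _ _ hmu _ hP (n - M) (N + M) (Phi * S).
- have [->|S0] := eqVneq S 0; first by rewrite mulr0 size_poly0.
  by rewrite size_PhiM // -idx; lia.
(* mu[Phi S x^q] = mut[S Psi x^q], and Psi x^q has degree M + q < n. *)
- move=> q lt_q; have := hmut (S * 'X^q); rewrite /polymul !mulrA => <-.
  rewrite -mulrA mulrCA; apply: (monic_orthogonal_size_lt _ _ n) => //.
  by rewrite size_monicM ?monicPsi ?sizePsi -?size_poly_eq0 ?size_polyXn //; lia.
rewrite -idx in Fc; exists c => //.
apply/(PQ_mx_mulmx_eq0 _ _ _ _ _ _ _ _ _ (1 + (N + M))%N c).
rewrite [\sum_(j < _) _](_ : _ = Phi * S) ?Fc //; split=> k.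
  by rewrite -Fc hornerM horner_prod (bigD1 k) //= hornerXsubC subrr !mul0r.
(* Here muc[Phi S Psi/(x - w_k)] = mut[S Psi/(x - w_k)], with a test polynomial of degree M - 1 <
   n. *)
rewrite -Fc -mulrA; have := hmuc (S * (Psi %/ ('X - (w k)%:P))).
rewrite /polymul => ->; apply: (monic_orthogonal_size_lt _ _ n) => //.
by rewrite size_divp ?polyXsubC_eq0 // sizePsi size_XsubC; lia.
Qed.

Lemma solution_of_kernel (c : nat -> K) :
  A *m (\col_j c j) = 0 ->
  exists2 S : {poly K}, Phi * S = comb c & orthogonal_solution mut n S.
Proof.
move/(PQ_mx_mulmx_eq0 _ _ _ _ _ _ _ _ _ (1 + (N + M))%N c).
rewrite -/(comb c) => -[Fz Fw].
(* The z_k are distinct, so vanishing at each of them gives divisibility by the product. *)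
have dvdF : Phi %| comb c.
  rewrite /Phi -(big_map z xpredT (fun x => 'X - x%:P)).
  apply: uniq_roots_dvdp.
    by apply/allP => _ /mapP[k _ ->]; rewrite rootE Fz.
  by rewrite uniq_rootsE map_inj_uniq // /index_enum -enumT enum_uniq.
have FS : Phi * (comb c %/ Phi) = comb c by rewrite mulrC divpK.
move: (comb c %/ Phi) FS => S FS.
exists S => //; split.
  have [->|S0] := eqVneq S 0; first by rewrite size_poly0.
  have := size_ortho_comb _ _ sizeP (n + N) (N + M).+1 c.
  by rewrite -/(comb c) -FS size_PhiM //; lia.
move=> p lt_pn; set T := 'X^p.
have sT : (size T <= n)%N by rewrite size_polyXn.
have Psi0 : Psi != 0 by rewrite monic_neq0.
(* Divide x^p by Psi. The quotient part reduces to mu[F q] with deg q < n - M, which vanishes since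
   every index in F is at least n - M. The remainder is a combination of the Psi/(x - w_k), where
   the Q rows apply. *)
have [|b rb] := @lagrange_expansion _ _ _ hw (T %% Psi).
  by rewrite -ltnS -sizePsi ltn_modp.
rewrite (divp_eq T Psi) rb mulrDr raddfD /= [_ * Psi]mulrC mulrCA.
have := hmut (S * (T %/ Psi)); rewrite /polymul => ->.
rewrite mulrA FS /comb idx (ortho_comb_mu0 _ _ _ hP) ?add0r; last first.
  by rewrite size_divp // sizePsi leq_sub2r.
rewrite mulr_sumr raddf_sum big1 // => k _.
by rewrite /= -scalerAr linearZ /= -hmuc /polymul mulrA FS Fw mulr0.
Qed.

Lemma comb_eq0 (c : nat -> K) :
  comb c = 0 -> forall j, (j <= N + M)%N -> c j = 0.
Proof.
move=> Fc0 j le_j; apply: (ortho_comb_free _ _ monicP_ sizeP _ _ c _ Fc0) => //.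
by lia.
Qed.

Lemma coef_comb (c : nat -> K) : (comb c)`_(n + N) = c 0%N.
Proof. by rewrite coef_ortho_comb //; lia. Qed.

(** A zero first coordinate silences the first column, so solutions of degree below n correspond to
    the kernel of the square matrix of D_n. *)
Lemma A_mul0 (c : nat -> K) :
  c 0%N = 0 ->
  A *m (\col_j c j) =
    PQ_mx z w P muc Psi (n + N).-1 (N + M) *m (\col_j c j.+1).
Proof.
move=> c0; rewrite -PQ_mx_rsubmx -/A.
rewrite -[A in LHS]hsubmxK -[X in _ *m X](vsubmxK (m1 := 1)) mul_row_col.
rewrite [usubmx _](_ : _ = 0) ?mulmx0 ?add0r; last first.
  by apply/matrixP => i j; rewrite !mxE ord1.
by congr (_ *m _); apply/matrixP => i j; rewrite !mxE.
Qed.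

Lemma normal_index_Dn :
  normal_index mut n <-> Dn z w P muc Psi n != 0.
Proof.
split=> [nn|D0 S S0 solS].
  apply/negP => /eqP D0.
  have /eqP := D0; rewrite /Dn -det_tr => /det0P[v v0 vB].
  (* The kernel vector of the square matrix, preceded by a zero coordinate and extended by 0 beyond
     its range. *)
  pose c j := if j is j'.+1 then oapp (v 0) 0 (insub j' : option 'I_(N + M))
              else 0.
  have cv : \col_(j < N + M) c j.+1 = v^T.
    by apply/matrixP => i j; rewrite !mxE ord1 /= valK.
  have [|S FS solS] := solution_of_kernel c.
    by rewrite A_mul0 // cv -[LHS]trmxK trmx_mul trmxK vB trmx0.
  have S0 : S != 0.
    apply/eqP => S0; case/eqP: v0; apply: trmx_inj; rewrite -cv trmx0.
    move: FS; rewrite S0 mulr0 => /esym Fc0.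
    by apply/matrixP => i j; rewrite !mxE (comb_eq0 _ Fc0).
  have sS := nn S S0 solS.
  (* Normality makes the coefficient of x^n the leading one, yet it equals [c 0] = 0. *)
  have : lead_coef S = 0 by rewrite lead_coefE sS -coef_PhiM ?sS ?FS ?coef_comb.
  by move/eqP; rewrite lead_coef_eq0 (negPf S0).
have [sS _] := solS; apply/eqP; rewrite eqn_leq sS ltnNge /=.
apply/negP => sS'; have [c FS Ac] := kernel_of_solution S solS.
have c0 : c 0%N = 0.
  by rewrite -coef_comb -FS coef_PhiM // nth_default.
move: Ac; rewrite A_mul0 // => Bc.
have /(congr1 (mulmx (invmx (PQ_mx z w P muc Psi (n + N).-1 (N + M))))) := Bc.
rewrite mulKmx ?unitmxE ?unitfE // mulmx0 => c1.
case/eqP: S0; apply: (mulfI (monic_neq0 monicPhi)).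
rewrite mulr0 FS /comb ortho_comb_recl c0 scale0r add0r big1 // => j _.
by have /matrixP/(_ j 0) := c1; rewrite !mxE => ->; rewrite scale0r.
Qed.

Lemma numerator_solution :
  exists2 S : {poly K}, Phi * S = numerator z w P muc Psi n &
    orthogonal_solution mut n S /\ S`_n = Dn z w P muc Psi n.
Proof.
(* [inord] only extends the minors to all naturals; the range of the sum is unaffected. *)
pose c j := maxminor A (inord j : 'I_(N + M).+1).
have cE (j : 'I_(1 + (N + M))) : c j = maxminor A j.
  by rewrite /c (inord_val (j : 'I_(N + M).+1)).
have [|S FS solS] := solution_of_kernel c.
  rewrite -[RHS](mulmx_maxminor _ _ A); congr (_ *m _).
  by apply/matrixP => i j; rewrite !mxE cE.
exists S.
  rewrite FS /numerator det_col_mx_row; apply: eq_bigr => j _.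
  (* Below the top row all entries are constant polynomials, so the cofactors are the constants
     [c j]. *)
  rewrite mxE cE /maxminor -map_col' det_map_mx -(rmorph_sign polyC) -rmorphM.
  by rewrite /= -mul_polyC mulrC.
split=> //; have -> : Dn z w P muc Psi n = c 0%N.
  by rewrite (cE ord0) maxminor0 PQ_mx_rsubmx.
by rewrite -coef_comb -FS coef_PhiM //; case: solS.
Qed.

Lemma monic_orthogonal_Dn :
  Dn z w P muc Psi n != 0 ->
  exists Pt : {poly K}, unique (monic_orthogonal mut n) Pt /\
    Phi * Pt = (Dn z w P muc Psi n)^-1 *: numerator z w P muc Psi n.
Proof.
move=> D0; have nn := normal_index_Dn.2 D0.
have [S FS [solS Sn]] := numerator_solution.
have S0 : S != 0 by apply: contraNneq D0 => S0; rewrite -Sn S0 coef0.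
have sS := nn S S0 solS.
have lS : lead_coef S = Dn z w P muc Psi n by rewrite lead_coefE sS.
(* D_n is the leading coefficient of S, so this scaling makes S monic. *)
exists ((Dn z w P muc Psi n)^-1 *: S); split; last by rewrite -scalerAr FS.
have mPt : monic_orthogonal mut n ((Dn z w P muc Psi n)^-1 *: S).
  have sPt : size ((Dn z w P muc Psi n)^-1 *: S) = n.+1.
    by rewrite size_scale ?invr_eq0.
  split=> //; first by rewrite monicE lead_coefZ lS mulVf.
  split; rewrite ?sPt // => p lt_pn.
  by rewrite -scalerAl linearZ /= solS.2 ?mulr0.
split=> // T [mT sT [_ oT]].
set U := _ *: S in mPt *.
have [mU sU [_ oU]] := mPt.
apply/eqP; rewrite -subr_eq0; apply/negPn/negP => UT0.
(* The leading terms of two monic solutions cancel, and normality excludes a nonzero solution of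
   degree below n. *)
have sUT : (size (U - T)%R <= n)%N.
  apply/leq_sizeP => j; rewrite leq_eqVlt => /predU1P[<-|lt_nj].
    have := monicP mT; have := monicP mU; rewrite !lead_coefE sU sT /=.
    by rewrite coefB => -> ->; rewrite subrr.
  by rewrite coefB !nth_default ?sU ?sT ?subr0.
have oUT : orthogonal_solution mut n (U - T).
  split=> [|p lt_pn]; first exact: leqW.
  by rewrite mulrBl raddfB /= oU ?oT ?subr0.
by rewrite (nn _ UT0 oUT) ltnn in sUT.
Qed.

End Transform.

Theorem theorem2p6 (R : realType)
    (mu : {scalar {poly R[i]}}) (hmu : quasi_definite mu)
    (P : nat -> {poly R[i]}) (hP : forall n : nat, monic_orthogonal mu n (P n))
    (N M : nat) (z : 'I_N -> R[i]) (w : 'I_M -> R[i])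
    (hz : injective z) (hw : injective w)
    (Phi Psi : {poly R[i]})
    (hPhi : Phi = \prod_(k < N) ('X - (z k)%:P))
    (hPsi : Psi = \prod_(k < M) ('X - (w k)%:P))
    (mut : {scalar {poly R[i]}}) (hmut : polymul Psi mut =1 polymul Phi mu)
    (muc : {scalar {poly R[i]}}) (hmuc : polymul Phi muc =1 mut)
    (n : nat) (hn : (M <= n)%N) :
  (normal_index mut n <-> Dn z w P muc Psi n != 0) /\
  (Dn z w P muc Psi n != 0 ->
    exists Pt : {poly R[i]},
      unique (monic_orthogonal mut n) Pt /\
      (* the formula is an identity of rational functions *)
      tofrac Pt = (tofrac Phi)^-1 * tofrac ((Dn z w P muc Psi n)^-1)%:P
                  * tofrac (numerator z w P muc Psi n)).

Proof.
subst Phi Psi; split; first exact: normal_index_Dn.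
move/(monic_orthogonal_Dn _ _ hmu _ hP _ _ _ _ hz hw _ _ hmut hmuc _ hn).
move=> [Pt [uPt FPt]]; exists Pt; split=> //.
have Phi0 : tofrac (\prod_(k < N) ('X - (z k)%:P)) != 0.
  by rewrite tofrac_eq0 monic_neq0 // monic_prod_XsubC.
(* Clearing the denominator Phi in the fraction field reduces the formula to the polynomial identity
   [FPt]. *)
apply: (mulfI Phi0).
by rewrite -tofracM FPt -mul_polyC tofracM !mulrA divff // mul1r.
Qed.
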